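(* Let $\mathcal{B}=(T,E_{\mathcal{B}})$ be a demand network with root $o$, let $H=(V_H,E_H)$ be a physical network with injective terminal map $\iota:T\to V_H$, let $F\subseteq E_{\mathcal{B}}$ and $\mathcal{B}^{\sharp}=(T,F)$. Suppose that $\mathcal{B}^{\sharp}$ is repaired in $H$ by an $(L,K)$-controlled repair scheme $\{\gamma_e\}_{e\in F}$. Let $\Phi$ be a gauge such that $\alpha_\Phi(m)<\infty$ for $1\le m\le K$. If $\mathcal{B}^{\sharp}$ supports a unit flow $\theta$ from $o$ to infinity with finite $\Phi$-energy, then the connected component of $\iota(o)$ in $H$ supports a unit flow $\Theta$ from $\iota(o)$ to infinity satisfying $$\mathcal{E}^\Phi_H(\Theta)\le L\,\beta_\Phi(K)\,\mathcal{E}^\Phi_{\mathcal{B}^{\sharp}}(\theta).$$ In particular, for $\Phi(t)=t^q$ with $q>1$, $$\mathcal{E}^q_H(\Theta)\le L\,K^{q-1}\,\mathcal{E}^q_{\mathcal{B}^{\sharp}}(\theta).$$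
   Context: Graphs are locally finite and undirected; flows are antisymmetric functions on oriented edges. Since flows to infinity are considered, the graphs are infinite. A demand network is a connected locally finite multigraph $\mathcal{B}=(T,E_{\mathcal{B}})$ (parallel edges allowed) with a distinguished root $o\in T$. A physical network is a locally finite graph $H=(V_H,E_H)$ together with an injective map $\iota:T\to V_H$. A unit flow from $o$ to infinity on a locally finite graph is an antisymmetric function $\theta$ on oriented edges with $\operatorname{div}\theta(o)=1$ and $\operatorname{div}\theta(x)=0$ for $x\ne o$, where $\operatorname{div}\theta(x)$ is the sum of $\theta$ over all oriented edges leaving $x$ (parallel edges counted separately). A gauge is an increasing convex function $\Phi:[0,\infty)\to[0,\infty)$ with $\Phi(0)=0$ (increasing is understood strictly, so that $\Phi(t)>0$ for $t>0$). The $\Phi$-energy of a flow on a graph $X$ is $\mathcal{E}^\Phi_X(\theta)=\sum_{e\in E_X}\Phi(|\theta(e)|)$, the sum being over unoriented edges; for $\Phi(t)=t^q$ it is written $\mathcal{E}^q_X(\theta)$. For integers $m\ge1$ put $\alpha_\Phi(m)=\sup_{t>0}\Phi(mt)/\Phi(t)$, and for an integer $K\ge 1$ put $\beta_\Phi(K)=\max_{1\le m\le K}\alpha_\Phi(m)/m$. A repair scheme for $F\subseteq E_{\mathcal{B}}$ assigns to each $e=\{u,v\}\in F$ a finite path $\gamma_e$ in $H$ joining $\iota(u)$ to $\iota(v)$; $|\gamma_e|$ is its number of edges. It is $(L,K)$-controlled if $|\gamma_e|\le L$ for all $e\in F$ and every physical edge $a\in E_H$ lies on at most $K$ of the paths $\gamma_e$,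 $e\in F$. *)

(* Defs.v *)
From HB Require Import structures.
From mathcomp Require Import all_boot all_order all_algebra.
From mathcomp Require Import all_classical all_reals all_analysis.

Set Implicit Arguments.
Unset Strict Implicit.
Unset Printing Implicit Defensive.

Import Order.TTheory GRing.Theory Num.Theory.

Local Open Scope classical_set_scope.
Local Open Scope ring_scope.

(* An unoriented edge is a point of [edge], and [ends] lists its two end points
   in an arbitrary reference order.  Parallel edges are allowed; a loop, if
   there is one, has two orientations like any other edge. *)
Record multigraph := Multigraph {
  vertex : choiceType;
  edge : choiceType;
  ends : edge -> vertex * vertex
}.

(* Oriented edges: [(e, true)] is [e] in the reference orientation. *)
Definition dart (G : multigraph) : choiceType := (edge G * bool)%type.

Definition dsrc (G : multigraph) (d : dart G) : vertex G :=
  if d.2 then (ends d.1).1 else (ends d.1).2.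

Definition drev (G : multigraph) (d : dart G) : dart G := (d.1, ~~ d.2).

Definition dtgt (G : multigraph) (d : dart G) : vertex G := dsrc (drev d).

Definition out_darts (G : multigraph) (x : vertex G) : set (dart G) :=
  [set d | dsrc d = x].

Definition locally_finite (G : multigraph) : Prop :=
  forall x : vertex G, finite_set (out_darts x).

Fixpoint walk (G : multigraph) (x : vertex G) (p : seq (dart G))
    (y : vertex G) : Prop :=
  if p is d :: p' then dsrc d = x /\ walk (dtgt d) p' y else x = y.

(* A path is a walk that does not visit a vertex twice; its number of edges
   is [size p]. *)
Definition is_path (G : multigraph) (x : vertex G) (p : seq (dart G))
    (y : vertex G) : Prop :=
  walk x p y /\ uniq (x :: [seq dtgt d | d <- p]).

Definition on_path (G : multigraph) (a : edge G) (p : seq (dart G)) : bool :=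
  a \in [seq d.1 | d <- p].

Definition joined (G : multigraph) (x y : vertex G) : Prop :=
  exists p : seq (dart G), walk x p y.

Definition connected_graph (G : multigraph) : Prop :=
  forall x y : vertex G, joined x y.

(* The edges of the connected component of [x]. *)
Definition component_edges (G : multigraph) (x : vertex G) : set (edge G) :=
  [set e | joined x (ends e).1].

(* The graph with the vertices of [G] and only the edges in [F]. *)
Definition spanning_subgraph (G : multigraph) (F : set (edge G)) : multigraph :=
  @Multigraph (vertex G) (set_type F) (fun e => ends (val e)).

Definition divergence (R : realType) (G : multigraph) (theta : dart G -> R)
    (x : vertex G) : R :=
  \sum_(d \in out_darts x) theta d.

Definition antisymmetric_flow (R : realType) (G : multigraph)
    (theta : dart G -> R) : Prop :=
  forall d : dart G, theta (drev d) = - theta d.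

(* Meaningful on locally finite graphs, where the sums in [divergence] are finite. *)
Definition unit_flow (R : realType) (G : multigraph) (o : vertex G)
    (theta : dart G -> R) : Prop :=
  [/\ antisymmetric_flow theta,
      divergence theta o = 1 &
      forall x : vertex G, x <> o -> divergence theta x = 0].

(* A function on the oriented edges of the component of [x] is identified with
   its extension by zero to all oriented edges of [G]. *)
Definition carried_by_component (R : realType) (G : multigraph) (x : vertex G)
    (theta : dart G -> R) : Prop :=
  forall d : dart G, ~ component_edges x d.1 -> theta d = 0.

(* Only the restriction of [Phi] to [0, +oo) is meaningful. *)
Definition is_gauge (R : realType) (Phi : R -> R) : Prop :=
  [/\ Phi 0 = 0,
      forall t : R, 0 <= t -> 0 <= Phi t,
      forall s t : R, 0 <= s -> s < t -> Phi s < Phi t &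
      convex_function (`[0, +oo[%classic : set R) Phi].

(* By antisymmetry the choice of orientation of [e] is immaterial. *)
Definition energy (R : realType) (Phi : R -> R) (G : multigraph)
    (theta : dart G -> R) : \bar R :=
  \esum_(e in [set: edge G]) (Phi `|theta (e, true)|)%:E.

Definition alpha (R : realType) (Phi : R -> R) (m : nat) : \bar R :=
  ereal_sup [set (Phi (m%:R * t) / Phi t)%:E | t in [set t : R | 0 < t]].

Definition beta (R : realType) (Phi : R -> R) (K : nat) : \bar R :=
  \big[maxe/-oo%E]_(1 <= m < K.+1) (alpha Phi m * (m%:R^-1)%:E)%E.

(* [gamma e] joins the images of the end points of [e], for every edge [e]
   of [X]. *)
Definition repair_scheme (X H : multigraph) (iota : vertex X -> vertex H)
    (gamma : edge X -> seq (dart H)) : Prop :=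
  forall e : edge X,
    is_path (iota (ends e).1) (gamma e) (iota (ends e).2).

Definition controlled (X H : multigraph) (gamma : edge X -> seq (dart H))
    (L K : nat) : Prop :=
  (forall e : edge X, (size (gamma e) <= L)%N) /\
  (forall a : edge H, [set e : edge X | on_path a (gamma e)] #<= `I_K)%card.

(* Main.v *)
Require Import Defs.
From mathcomp Require Import all_boot all_order all_algebra.
From mathcomp Require Import all_classical all_reals all_analysis.
From mathcomp Require Import ring lra.

Set Implicit Arguments.
Unset Strict Implicit.
Unset Printing Implicit Defensive.

Import Order.TTheory GRing.Theory Num.Theory.

Local Open Scope classical_set_scope.
Local Open Scope ring_scope.

(** Every demand edge [e] is replaced by its path [gamma e] in [H], and the
    amount [theta e] that used to flow through [e] is pushed along that path.
    The net amount pushed across an edge of [H] is the new flow [rerouted].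

    It is again a unit flow: a walk that enters a vertex leaves it, except at
    its two end points, so a walk from [iota u] to [iota v] carrying one unit
    has divergence [1] at [iota u], [-1] at [iota v] and [0] elsewhere, with
    cancellation if [u = v] ([traversal_out]).  Summing over [e], the divergence of the new flow at
    [z] is the sum of [theta] over the demand edges leaving the preimages of
    [z] under [iota] ([divergence_rerouted]).  As [iota] is injective, there is
    at most one such preimage [t], and the sum is the divergence of [theta] at
    [t].  Local finiteness of both graphs and the bound [K] on the overlap make
    all these sums finite.  Setting the flow to zero outside the component of
    [iota o] keeps it a unit flow, since no edge leaves the component, and does
    not increase the energy.

    For the energy, a path uses an edge at most once, so the flow across a
    physical edge [a] is at most the sum of the [|theta e|] over the paths
    through [a], of which there are [m <= K].  If [m >= 1], Jensen's inequality and the definition of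
    [alpha] give
    [Phi (x_1 + ... + x_m) <= alpha m / m * (Phi x_1 + ... + Phi x_m)]
    ([gauge_sum]).  Summing over [a] and exchanging the sums counts each [e]
    once for every edge of its path, hence at most [L] times
    ([energy_rerouted]).

    All estimates are made with a real upper bound [b] of [beta Phi K].  Such a
    bound is [beta Phi K] itself for a general gauge, and [K ^ (q - 1)] for
    [t ^ q], where [alpha m = m ^ q]. *)

(** * Darts and paths *)

Lemma drevK (G : multigraph) : involutive (@drev G).
Proof. by case=> e b; rewrite /drev/= negbK. Qed.

Lemma same_edge_darts (G : multigraph) (d a : dart G) :
  d.1 = a.1 -> d = a \/ d = drev a.
Proof.
case: d a => [e b] [f c] /= ->; rewrite /drev /=.
by case: b c => -[]; [left|right|right|left].
Qed.

(** A second use of an edge, in either direction, would revisit one of its end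
    points. *)
Lemma path_uniq_edges (G : multigraph) (x : vertex G) p y :
  is_path x p y -> uniq [seq d.1 | d <- p].
Proof.
case; elim: p x => [//|d p IH] x /= [dx wp] /andP[xNd] /andP[dNp up].
apply/andP; split; last by apply: IH wp _; rewrite /= dNp.
apply/negP => /mapP[a ap /same_edge_darts[ad|ard]].
- by move/negP: dNp; apply; apply/mapP; exists a => //; rewrite ad.
- move: xNd; rewrite inE negb_or => /andP[_ /negP]; apply.
  by apply/mapP; exists a => //; rewrite -dx ard.
Qed.

Lemma finite_paths_through (X H : multigraph) (gamma : edge X -> seq (dart H)) L K
    (a : edge H) :
  controlled gamma L K -> finite_set [set e | on_path a (gamma e)].
Proof. by case=> _ /(_ a) cK; apply: card_le_finite cK (finite_II K). Qed.

(** * The net number of times that a walk crosses a dart *)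

Definition crossing (R : realType) (G : multigraph) (d a : dart G) : R :=
  (d == a)%:R - (drev d == a)%:R.

Definition traversal (R : realType) (G : multigraph) (p : seq (dart G))
    (a : dart G) : R :=
  \sum_(d <- p) crossing R d a.

Lemma traversal_drev (R : realType) (G : multigraph) (p : seq (dart G)) (a : dart G) :
  traversal R p (drev a) = - traversal R p a.
Proof.
rewrite /traversal -sumrN; apply: eq_bigr => d _; rewrite /crossing opprB.
by rewrite (inj_eq (can_inj (@drevK G))) -(inj_eq (can_inj (@drevK G))) drevK.
Qed.

Lemma traversal_off_path (R : realType) (G : multigraph) (p : seq (dart G))
    (a : dart G) :
  ~~ on_path a.1 p -> traversal R p a = 0.
Proof.
move=> aNp; rewrite /traversal big_seq big1// => d dp; rewrite /crossing.
have da : d.1 != a.1.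
  by apply: contra aNp => /eqP <-; apply/mapP; exists d.
have /negbTE -> : d != a by apply: contra da => /eqP ->.
have /negbTE -> : drev d != a by apply: contra da => /eqP <-.
by rewrite subrr.
Qed.

Lemma normr_crossing_le1 (R : realType) (G : multigraph) (d a : dart G) :
  `|crossing R d a| <= 1.
Proof.
by rewrite /crossing; do 2 case: (_ == _);
  rewrite ?subrr ?subr0 ?sub0r ?normrN ?normr1 ?normr0.
Qed.

Lemma normr_traversal_le1 (R : realType) (G : multigraph) (p : seq (dart G))
    (a : dart G) :
  uniq [seq d.1 | d <- p] -> `|traversal R p a| <= 1.
Proof.
elim: p => [_|d p IH /= /andP[dNp up]]; first by rewrite /traversal big_nil normr0.
rewrite /traversal big_cons -/(traversal R p a).
have [da|da] := eqVneq d.1 a.1.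
  by rewrite traversal_off_path ?addr0 ?normr_crossing_le1// /on_path -da.
suff -> : crossing R d a = 0 by rewrite add0r IH.
have -> : crossing R d a = traversal R [:: d] a.
  by rewrite /traversal big_seq1.
by apply: traversal_off_path; rewrite /on_path /= inE eq_sym.
Qed.

Lemma crossing_out (R : realType) (G : multigraph) (z : vertex G) (d : dart G) :
  locally_finite G ->
  \sum_(a \in out_darts z) crossing R d a = (dsrc d == z)%:R - (dtgt d == z)%:R.
Proof.
move=> /(_ z) fz.
have out_delta (c : dart G) :
    \sum_(a \in out_darts z) ((c == a)%:R : R) = (dsrc c == z)%:R.
  have [cz|cz] := eqVneq (dsrc c) z.
    rewrite (fsbigE [:: c])//= ?big_cons ?big_nil ?mem_set ?eqxx ?addr0//.
      by move=> a; rewrite /= inE => /eqP ->.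
    by move=> a _; rewrite inE eq_sym => /negbTE ->.
  rewrite fsbig1// => a /= az; case: eqP => // ca.
  by move: cz; rewrite ca az eqxx.
rewrite -(out_delta d) -(out_delta (drev d)) !fsbig_finite// -sumrB.
by apply: eq_bigr.
Qed.

(** The contributions of consecutive darts telescope.  Loops and repeated
    vertices do no harm, because crossings are counted with sign. *)
Lemma traversal_out (R : realType) (G : multigraph) (x : vertex G) p y z :
  locally_finite G -> walk x p y ->
  \sum_(a \in out_darts z) traversal R p a = (x == z)%:R - (y == z)%:R.
Proof.
move=> lfG; elim: p x => [|d p IH] x /=.
  by move=> ->; rewrite subrr fsbig1// => a _; rewrite /traversal big_nil.
move=> [<- /IH e].
have -> : traversal R (d :: p) = fun a => crossing R d a + traversal R p a.
  by apply/funext => a; rewrite /traversal big_cons.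
rewrite fsbig_split; last exact: lfG.
by rewrite e (crossing_out R z d lfG) /= addrA subrK.
Qed.

(** * Rerouting a flow along the paths *)

Definition rerouted (R : realType) (X H : multigraph)
    (gamma : edge X -> seq (dart H)) (theta : dart X -> R) (a : dart H) : R :=
  \sum_(e \in [set e | on_path a.1 (gamma e)]) theta (e, true) * traversal R (gamma e) a.

Lemma antisymmetric_rerouted (R : realType) (X H : multigraph)
    (gamma : edge X -> seq (dart H)) (theta : dart X -> R) :
  antisymmetric_flow (rerouted gamma theta).
Proof.
move=> a; rewrite -[RHS]mulN1r mulr_fsumr; apply: eq_fsbigr => e _.
by rewrite traversal_drev mulN1r mulrN.
Qed.

(** Grouping the two orientations of each edge turns a sum over darts into a sum
    over edges.  A predicate [P] instead of a single vertex allows for the set of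
    preimages of a vertex of [H]; a superset [S] of the relevant edges allows the
    comparison with other sums over [S]. *)
Lemma sum_out_darts (R : realType) (X : multigraph) (theta : dart X -> R)
    (P : pred (vertex X)) (S : set (edge X)) :
  antisymmetric_flow theta -> finite_set S ->
  (forall d : dart X, P (dsrc d) -> S d.1) ->
  \sum_(d \in [set d | P (dsrc d)]) theta d =
  \sum_(e \in S) theta (e, true) * ((P (ends e).1)%:R - (P (ends e).2)%:R).
Proof.
move=> anti fS PS.
have -> : [set d : dart X | P (dsrc d)] =
    (S `*` [set: bool]) `&` [set d | P (dsrc d)].
  by apply/seteqP; split=> [d Pd|d []//]; split=> //; split=> //; exact: PS.
rewrite fsbig_mkcondr.
have fbool : finite_set [set: bool] by exact: finite_finset.
transitivity (\sum_(e \in S) \sum_(b \in [set: bool])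
    (if (e, b) \in [set d : dart X | P (dsrc d)] then theta (e, b) else 0)).
  by rewrite pair_fsbig//; apply: eq_fsbigr => -[].
apply: eq_fsbigr => e _.
rewrite (fsbigE [:: true; false])//; last by case.
have inT (b : bool) : (b \in [set: bool]) = true by exact: mem_set.
rewrite !big_cons big_nil !inT /= addr0.
have -> : theta (e, false) = - theta (e, true) by rewrite -anti.
have inP (d : dart X) : (d \in [set d : dart X | P (dsrc d)]) = P (dsrc d).
  by apply/idP/idP; rewrite inE.
rewrite !inP /dsrc /=.
by case: (P (ends e).1); case: (P (ends e).2) => /=; ring.
Qed.

(** After exchanging the sum over the darts at [z] with the sum over the demand
    edges, each [gamma e] contributes through its end points only. *)
Lemma divergence_rerouted (R : realType) (X H : multigraph)
    (iota : vertex X -> vertex H) (gamma : edge X -> seq (dart H))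
    (L K : nat) (theta : dart X -> R) (z : vertex H) :
  locally_finite X -> locally_finite H -> injective iota ->
  repair_scheme iota gamma -> controlled gamma L K -> antisymmetric_flow theta ->
  divergence (rerouted gamma theta) z =
  \sum_(d \in [set d | iota (dsrc d) == z]) theta d.
Proof.
move=> lfX lfH iotaI rep ctrl anti.
pose Sz := [set d : dart X | iota (dsrc d) == z].
have fSz : finite_set Sz.
  have [[t tz]|nt] := pselect (exists t, iota t = z).
    by apply: sub_finite_set (lfX t) => d /= /eqP; rewrite -tz => /iotaI.
  by apply: sub_finite_set (@finite_set0 _) => d /= /eqP dz; case: nt; exists (dsrc d).
(* The first part carries the terms of the flow at [z].  The second is there for
   demand edges at a preimage of [z] whose path is empty, namely loops. *)
pose S := (\bigcup_(a in out_darts z) [set e | on_path a.1 (gamma e)]) `|` fst @` Sz.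
have fS : finite_set S.
  rewrite finite_setU; split; last exact: finite_image.
  apply: bigcup_finite; first exact: lfH.
  by move=> a _; exact: finite_paths_through ctrl.
rewrite (sum_out_darts (P := fun t => iota t == z) anti fS); last first.
  by move=> d dz; right; exists d.
transitivity (\sum_(a \in out_darts z) \sum_(e \in S)
    theta (e, true) * traversal R (gamma e) a).
  apply: eq_fsbigr => a; rewrite inE => az; apply: fsbig_widen.
    by move=> e ae; left; exists a.
  by move=> e [_ /= /negP aNe]; rewrite traversal_off_path ?mulr0.
rewrite exchange_fsbig//; apply: eq_fsbigr => e _.
by rewrite -mulr_fsumr (traversal_out _ _ lfH (rep e).1).
Qed.

Lemma unit_flow_rerouted (R : realType) (X H : multigraph)
    (iota : vertex X -> vertex H) (gamma : edge X -> seq (dart H))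
    (L K : nat) (o : vertex X) (theta : dart X -> R) :
  locally_finite X -> locally_finite H -> injective iota ->
  repair_scheme iota gamma -> controlled gamma L K -> unit_flow o theta ->
  unit_flow (iota o) (rerouted gamma theta).
Proof.
move=> lfX lfH iotaI rep ctrl [anti o1 x0].
have div_iota t : divergence (rerouted gamma theta) (iota t) = divergence theta t.
  rewrite (divergence_rerouted (iota t) lfX lfH iotaI rep ctrl anti).
  apply: eq_fsbigl; apply/seteqP; split => d /=.
    by move=> /eqP/iotaI.
  by move=> ->.
split; first exact: antisymmetric_rerouted.
  by rewrite div_iota.
move=> z zo; have [[t tz]|nt] := pselect (exists t, iota t = z).
  by rewrite -tz div_iota x0// => to; apply: zo; rewrite -tz to.
rewrite (divergence_rerouted z lfX lfH iotaI rep ctrl anti).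
by apply: fsbig1 => d /= /eqP dz; case: nt; exists (dsrc d).
Qed.

(** * Restriction to a connected component *)

Definition component_part (R : realType) (G : multigraph) (x : vertex G)
    (theta : dart G -> R) (d : dart G) : R :=
  if d.1 \in component_edges x then theta d else 0.

Lemma walk_cat (G : multigraph) (x y z : vertex G) p q :
  walk x p y -> walk y q z -> walk x (p ++ q) z.
Proof. by elim: p x => [|d p IH] x /= => [->//|[dx /IH h] /h]. Qed.

Lemma joined_dart (G : multigraph) (x : vertex G) (d : dart G) :
  joined x (dsrc d) -> joined x (dtgt d).
Proof. by case=> p wp; exists (p ++ [:: d]); apply: walk_cat wp _. Qed.

Lemma component_edgesE (G : multigraph) (x : vertex G) (d : dart G) :
  component_edges x d.1 <-> joined x (dsrc d).
Proof.
case: d => e [] //; rewrite /component_edges /=; split=> h.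
- exact: (@joined_dart _ _ (e, true)).
- exact: (@joined_dart _ _ (e, false)).
Qed.

(** The edges at a vertex are either all inside or all outside the component, so
    the divergence at that vertex is kept or becomes zero; the source is inside. *)
Lemma unit_flow_component_part (R : realType) (G : multigraph) (x : vertex G)
    (theta : dart G -> R) :
  unit_flow x theta -> unit_flow x (component_part x theta).
Proof.
move=> [anti x1 y0].
have div_in y : joined x y -> divergence (component_part x theta) y = divergence theta y.
  move=> xy; apply: eq_fsbigr => d; rewrite inE /component_part => /= dy.
  by rewrite mem_set//; apply/component_edgesE; rewrite dy.
have div_out y : ~ joined x y -> divergence (component_part x theta) y = 0.
  move=> xy; apply: fsbig1 => d /= dy; rewrite /component_part memNset//.
  by move=> /component_edgesE; rewrite dy.
split.
- by move=> d; rewrite /component_part anti /=; case: ifP => //; rewrite oppr0.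
- by rewrite div_in//; exists [::].
- move=> y yx; have [xy|xy] := pselect (joined x y); last exact: div_out.
  by rewrite div_in// y0.
Qed.

Lemma energy_component_part (R : realType) (Phi : R -> R) (G : multigraph)
    (x : vertex G) (theta : dart G -> R) :
  is_gauge Phi -> (energy Phi (component_part x theta) <= energy Phi theta)%E.
Proof.
move=> [Phi0 Phi_ge0 _ _]; apply: le_esum => e _; rewrite lee_fin /component_part.
by case: ifP => // _; rewrite normr0 Phi0 Phi_ge0.
Qed.

(** * Convexity estimates for gauges *)

(** The ratio [Phi (m t) / Phi t] is one of those whose supremum is [alpha m]; at
    [t = 0] both sides vanish. *)
Lemma gauge_scaling (R : realType) (Phi : R -> R) (K m : nat) (b t : R) :
  is_gauge Phi -> (beta Phi K <= b%:E)%E -> (1 <= m <= K)%N -> 0 <= t ->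
  Phi (m%:R * t) <= b * m%:R * Phi t.
Proof.
move=> [Phi0 _ Phi_incr _] bb mK.
rewrite le_eqVlt => /predU1P[<-|t0]; first by rewrite mulr0 Phi0 mulr0.
have m0 : 0 < m%:R :> R by rewrite ltr0n; case/andP: mK.
have Phit : 0 < Phi t by rewrite -Phi0; exact: Phi_incr.
rewrite -ler_pdivrMr// -ler_pdivrMr// -lee_fin; apply: le_trans bb.
apply: (@le_trans _ _ (alpha Phi m * (m%:R^-1)%:E)%E).
  rewrite EFinM lee_wpmul2r ?lee_fin ?invr_ge0 ?ler0n//.
  by rewrite /alpha; apply: ereal_sup_ubound; exists t.
by rewrite /beta; apply: (bigmax_sup_seq _ m); rewrite ?mem_index_iota.
Qed.

(** In fact [b >= 1], because [alpha 1 = 1]. *)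
Lemma beta_bound_ge0 (R : realType) (Phi : R -> R) (K : nat) (b : R) :
  is_gauge Phi -> (beta Phi K <= b%:E)%E -> (1 <= K)%N -> 0 <= b.
Proof.
move=> gPhi bb K1; apply: le_trans ler01 _.
have Phi1 : 0 < Phi 1 by case: gPhi => Phi0 _ incr _; rewrite -Phi0; apply: incr.
by have := gauge_scaling (m := 1) gPhi bb K1 ler01; rewrite !mulr1 ler_pMl.
Qed.

(** Jensen's inequality for equal weights.  The average of [n + 1] numbers is a
    convex combination of the first one and of the average of the other [n], with
    weights [1 / (n + 1)] and [n / (n + 1)]. *)
Lemma gauge_jensen (R : realType) (Phi : R -> R) (s : seq R) :
  is_gauge Phi -> (forall x, x \in s -> 0 <= x) -> s != [::] ->
  (size s)%:R * Phi ((\sum_(x <- s) x) / (size s)%:R) <= \sum_(x <- s) Phi x.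
Proof.
move=> [Phi0 _ _ cvx].
elim: s => [//|x [|y s] IH] s_ge0 _.
  by rewrite !big_seq1 /= mul1r divr1.
set s' := y :: s in IH s_ge0 *.
have s'_ge0 : forall z, z \in s' -> 0 <= z.
  by move=> z zs; apply: s_ge0; rewrite inE zs orbT.
have n0 : 0 < (size s')%:R :> R by rewrite ltr0n.
set n : R := (size s')%:R in IH n0 *.
have sz : (size (x :: s'))%:R = n + 1 :> R by rewrite /= -natr1.
have {}IH := IH s'_ge0 isT; clearbody n s'.
rewrite sz !big_cons; apply: (le_trans _ (lerD (lexx _) IH)).
set A := \sum_(z <- s') z.
have A0 : 0 <= A / n.
  by apply: divr_ge0 (ltW n0); rewrite /A big_seq; apply: sumr_ge0.
have x0 : 0 <= x by apply: s_ge0; rewrite mem_head.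
have t0 : 0 <= (n + 1)^-1 by rewrite invr_ge0; lra.
have t1 : (n + 1)^-1 <= 1 by rewrite invf_le1; lra.
have h : Phi ((n + 1)^-1 * x + (1 - (n + 1)^-1) * (A / n)) <=
    (n + 1)^-1 * Phi x + (1 - (n + 1)^-1) * Phi (A / n).
  by apply: (cvx (Itv01 t0 t1)); rewrite inE /= in_itv /= andbT.
have n1 : 0 < n + 1 by lra.
have -> : (x + A) / (n + 1) = (n + 1)^-1 * x + (1 - (n + 1)^-1) * (A / n).
  by field; rewrite !gt_eqF.
rewrite mulrC -ler_pdivlMr//; apply: (le_trans h).
by rewrite le_eqVlt; apply/orP; left; apply/eqP; field; rewrite !gt_eqF.
Qed.

(** The sum is [m] times the average: [gauge_scaling] bounds the effect of the
    factor [m], and Jensen's inequality that of the average. *)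
Lemma gauge_sum (R : realType) (Phi : R -> R) (K : nat) (b : R) (s : seq R) :
  is_gauge Phi -> (beta Phi K <= b%:E)%E -> (forall x, x \in s -> 0 <= x) ->
  (size s <= K)%N ->
  Phi (\sum_(x <- s) x) <= b * \sum_(x <- s) Phi x.
Proof.
move=> gPhi bb s_ge0 sK; case: s s_ge0 sK => [|y s'] s_ge0 sK.
  by rewrite !big_nil mulr0; case: gPhi => ->.
set s := y :: s' in s_ge0 sK *; set m : R := (size s)%:R.
have m0 : 0 < m by rewrite ltr0n.
have Am0 : 0 <= (\sum_(x <- s) x) / m.
  by apply: divr_ge0 (ltW m0); rewrite big_seq; apply: sumr_ge0.
have b0 : 0 <= b := beta_bound_ge0 gPhi bb (leq_trans (ltn0Sn _) sK).
rewrite -[X in Phi X](divfK (lt0r_neq0 m0)) mulrC.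
apply: (le_trans (gauge_scaling gPhi bb _ Am0)); first by rewrite sK.
by rewrite -mulrA ler_wpM2l// gauge_jensen.
Qed.

(** * Energy of the rerouted flow *)

(** Both sides are the sum over the pairs related by [r]. *)
Lemma esum_exchange (R : realType) (T1 T2 : choiceType) (r : T1 -> T2 -> Prop)
    (a : T1 -> T2 -> \bar R) :
  (forall i j, 0 <= a i j)%E ->
  \esum_(i in [set: T1]) \esum_(j in [set j | r i j]) a i j =
  \esum_(j in [set: T2]) \esum_(i in [set i | r i j]) a i j.
Proof.
move=> a0; rewrite !esum_esum//.
rewrite (@reindex_esum _ _ _ ([set: T2] `*`` (fun j => [set i | r i j])) _
  (fun k => (k.2, k.1)))//.
split.
- by move=> [j i] [].
- by move=> [j i] [j' i'] _ _ [-> ->].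
- by move=> [i j] [_ rij]; exists (j, i).
Qed.

Lemma esumZl_le (R : realType) (T : choiceType) (c : R) (f : T -> \bar R) :
  0 <= c -> (forall i, 0 <= f i)%E ->
  (\esum_(i in [set: T]) (c%:E * f i) <= c%:E * \esum_(i in [set: T]) f i)%E.
Proof.
move=> c0 f0; apply: ge_ereal_sup => _ /= [X fX <-].
rewrite -ge0_mule_fsumr// lee_wpmul2l ?lee_fin//.
by apply: ereal_sup_ubound; exists X.
Qed.

Lemma esum_seq_const (R : realType) (T : choiceType) (r : seq T) (c : R) :
  uniq r -> 0 <= c ->
  \esum_(i in [set i | i \in r]) c%:E = ((size r)%:R * c)%:E.
Proof.
move=> ur c0; have fr : finite_set [set i | i \in r] by exact: finite_seq.
rewrite esum_fset; [|by []|by move=> i _; rewrite lee_fin].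
rewrite -fsbig_seq// sumEFin; congr EFin.
by rewrite big_const_seq count_predT iter_addr_0 mulr_natl.
Qed.

(** A path crosses [a] at most once, in one of the two directions, so each of the
    at most [K] paths through [a] contributes at most [|theta e|]. *)
Lemma Phi_rerouted_le (R : realType) (Phi : R -> R) (X H : multigraph)
    (iota : vertex X -> vertex H) (gamma : edge X -> seq (dart H))
    (L K : nat) (b : R) (theta : dart X -> R) (a : dart H) :
  is_gauge Phi -> (beta Phi K <= b%:E)%E ->
  repair_scheme iota gamma -> controlled gamma L K ->
  Phi `|rerouted gamma theta a| <=
  b * \sum_(e \in [set e | on_path a.1 (gamma e)]) Phi `|theta (e, true)|.
Proof.
move=> gPhi bb rep ctrl.
have fS := finite_paths_through a.1 ctrl.
have Phi_le s t : 0 <= s -> s <= t -> Phi s <= Phi t.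
  case: gPhi => _ _ incr _ s0; rewrite le_eqVlt => /predU1P[->//|st].
  exact/ltW/incr.
pose r : seq (edge X) :=
  finmap.enum_fset (fset_set [set e | on_path a.1 (gamma e)]).
pose s := [seq `|theta (e, true)| | e <- r].
rewrite fsbig_finite// -/r -(big_map _ xpredT Phi) -/s.
apply: le_trans (gauge_sum gPhi bb _ _).
- apply: Phi_le => //; rewrite /rerouted fsbig_finite// big_map.
  apply: (le_trans (ler_norm_sum _ _ _)); apply: ler_sum => e _.
  rewrite normrM ler_piMr// normr_traversal_le1//.
  exact: path_uniq_edges (rep e).
- by move=> x /mapP[e _ ->].
- by rewrite size_map; apply: geq_card_fset_set; exact: ctrl.2.
Qed.

(** Summing [Phi_rerouted_le] over the physical edges counts each demand edge once
    for each of the at most [L] edges of its path. *)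
Lemma energy_rerouted (R : realType) (Phi : R -> R) (X H : multigraph)
    (iota : vertex X -> vertex H) (gamma : edge X -> seq (dart H))
    (L K : nat) (b : R) (theta : dart X -> R) :
  (1 <= K)%N -> is_gauge Phi -> (beta Phi K <= b%:E)%E ->
  repair_scheme iota gamma -> controlled gamma L K ->
  (energy Phi (rerouted gamma theta) <= (L%:R * b)%:E * energy Phi theta)%E.
Proof.
move=> K1 gPhi bb rep ctrl.
have b0 := beta_bound_ge0 gPhi bb K1.
have Phi0 (t : R) : 0 <= Phi `|t| by case: gPhi => _ + _ _; apply.
have bPhi0 (t : R) : 0 <= b * Phi `|t| by exact: mulr_ge0.
pose w e := b * Phi `|theta (e, true)|.
apply: (@le_trans _ _ (\esum_(a in [set: edge H])
    \esum_(e in [set e | on_path a (gamma e)]) (w e)%:E)).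
  apply: le_esum => a _.
  have fS := finite_paths_through a ctrl.
  rewrite esum_fset//; last by move=> e _; rewrite lee_fin bPhi0.
  rewrite fsbig_finite// sumEFin -fsbig_finite//= -mulr_fsumr lee_fin.
  exact: (@Phi_rerouted_le _ _ _ _ _ _ _ _ _ theta (a, true) gPhi bb rep ctrl).
rewrite esum_exchange; last by move=> a e; rewrite lee_fin bPhi0.
apply: le_trans (esumZl_le _ _); last 2 first.
- by rewrite mulr_ge0.
- by move=> e; rewrite lee_fin Phi0.
apply: le_esum => e _.
rewrite (esum_seq_const (path_uniq_edges (rep e)) (bPhi0 _)).
rewrite lee_fin -mulrA ler_wpM2r// ler_nat size_map; exact: ctrl.1.
Qed.

(** The form common to both parts of the theorem, which differ only in the choice
    of the upper bound [b]. *)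
Lemma reroute_unit_flow (R : realType) (Phi : R -> R) (X H : multigraph)
    (iota : vertex X -> vertex H) (gamma : edge X -> seq (dart H))
    (L K : nat) (b : R) (o : vertex X) (theta : dart X -> R) :
  locally_finite X -> locally_finite H -> injective iota -> (1 <= K)%N ->
  repair_scheme iota gamma -> controlled gamma L K ->
  is_gauge Phi -> (beta Phi K <= b%:E)%E -> unit_flow o theta ->
  exists Theta : dart H -> R,
    [/\ unit_flow (iota o) Theta, carried_by_component (iota o) Theta &
        (energy Phi Theta <= (L%:R * b)%:E * energy Phi theta)%E].
Proof.
move=> lfX lfH iotaI K1 rep ctrl gPhi bb uth.
exists (component_part (iota o) (rerouted gamma theta)); split.
- exact: unit_flow_component_part (unit_flow_rerouted lfX lfH iotaI rep ctrl uth).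
- by move=> d dNc; rewrite /component_part memNset.
- apply: le_trans (energy_component_part _ _ gPhi) _.
  exact: energy_rerouted K1 gPhi bb rep ctrl.
Qed.

(** * The two choices of the bound *)

Lemma locally_finite_spanning (G : multigraph) (F : set (edge G)) :
  locally_finite G -> locally_finite (spanning_subgraph F).
Proof.
move=> lfG x; pose inc (d : dart (spanning_subgraph F)) : dart G := (val d.1, d.2).
apply: (@finite_preimage _ _ (@out_darts G x) inc); last exact: lfG.
by move=> [e b] [e' b'] _ _ [/val_inj -> ->].
Qed.

Lemma beta_fin_num (R : realType) (Phi : R -> R) (K : nat) :
  is_gauge Phi -> (1 <= K)%N ->
  (forall m, (1 <= m <= K)%N -> (alpha Phi m < +oo)%E) ->
  beta Phi K \is a fin_num.
Proof.
move=> [Phi0 Phi_ge0 Phi_incr _] K1 alpha_fin.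
have alpha_ge0 m : (0 <= alpha Phi m)%E.
  apply: (@le_trans _ _ (Phi (m%:R * 1) / Phi 1)%:E).
    by rewrite lee_fin divr_ge0// Phi_ge0// mulr1.
  by rewrite /alpha; apply: ereal_sup_ubound; exists 1 => //=.
rewrite fin_real//; apply/andP; split.
  apply: (@lt_le_trans _ _ 0%E); first exact: ltNy0.
  apply: (bigmax_sup_seq _ 1%N); rewrite ?mem_index_iota//.
  by rewrite mule_ge0// lee_fin invr_ge0.
rewrite /beta big_seq; apply: bigmax_lt => [|m]; first by [].
rewrite mem_index_iota => mK.
have : alpha Phi m \is a fin_num by rewrite ge0_fin_numE// alpha_fin.
by move=> /fineK <-; rewrite -EFinM ltry.
Qed.

Lemma is_gauge_powR (R : realType) (q : R) :
  1 < q -> is_gauge (fun t : R => t `^ q).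
Proof.
move=> q1; have q0 : 0 < q by exact: lt_trans q1.
split.
- by rewrite powR0// gt_eqF.
- by move=> t _; exact: powR_ge0.
- move=> s t s0 st; apply: gt0_ltr_powR => //; rewrite nnegrE//.
  exact: le_trans (ltW st).
- exact: convex_powR (ltW q1).
Qed.

(** Here [(m t) ^ q / t ^ q = m ^ q], so the terms of the maximum are
    [m ^ q / m = m ^ (q - 1)], which increase with [m]. *)
Lemma beta_powR_le (R : realType) (q : R) (K : nat) :
  1 < q -> (beta (fun t : R => t `^ q)%R K <= (K%:R `^ (q - 1))%:E)%E.
Proof.
move=> q1; have q0 : 0 < q by exact: lt_trans q1.
rewrite /beta big_seq; apply: bigmax_le => [|m]; first exact: leNye.
rewrite mem_index_iota => /andP[m1 mK].
have m0 : 0 < m%:R :> R by rewrite ltr0n.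
apply: (@le_trans _ _ ((m%:R `^ q)%:E * (m%:R^-1)%:E)%E).
  rewrite lee_wpmul2r ?lee_fin ?invr_ge0//.
  apply: ge_ereal_sup => _ /= [t t0 <-]; rewrite lee_fin.
  by rewrite powRM ?ler0n ?(ltW t0)// mulfK ?lt0r_neq0 ?powR_gt0.
rewrite -EFinM lee_fin -(mulr_powRB1 (ltW m0) q0) mulrAC divff ?lt0r_neq0// mul1r.
by apply: ge0_ler_powR; rewrite ?nnegrE ?ler0n ?ler_nat// subr_ge0 ltW.
Qed.

Theorem theorem3p3 (R : realType)
    (* the demand network *)
    (B : multigraph) (o : vertex B)
    (B_infinite : infinite_set [set: vertex B])
    (B_locally_finite : locally_finite B)
    (B_connected : connected_graph B)
    (* the physical network *)
    (H : multigraph) (iota : vertex B -> vertex H)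
    (H_infinite : infinite_set [set: vertex H])
    (H_locally_finite : locally_finite H)
    (iota_injective : injective iota)
    (* the repaired subnetwork *)
    (F : set (edge B)) (L K : nat) (K_ge1 : (1 <= K)%N)
    (gamma : edge (spanning_subgraph F) -> seq (dart H))
    (gamma_repair : @repair_scheme (spanning_subgraph F) H iota gamma)
    (gamma_controlled : controlled gamma L K) :
  (forall Phi : R -> R,
     is_gauge Phi ->
     (forall m : nat, (1 <= m <= K)%N -> (alpha Phi m < +oo)%E) ->
     forall theta : dart (spanning_subgraph F) -> R,
       @unit_flow R (spanning_subgraph F) o theta ->
       (energy Phi theta < +oo)%E ->
       exists Theta : dart H -> R,
         [/\ unit_flow (iota o) Theta,
             carried_by_component (iota o) Theta &
             (energy Phi Theta <= L%:R%:E * beta Phi K * energy Phi theta)%E])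
  /\
  (forall q : R, 1 < q ->
     let pow_q := fun t : R => t `^ q in
     forall theta : dart (spanning_subgraph F) -> R,
       @unit_flow R (spanning_subgraph F) o theta ->
       (energy pow_q theta < +oo)%E ->
       exists Theta : dart H -> R,
         [/\ unit_flow (iota o) Theta,
             carried_by_component (iota o) Theta &
             (energy pow_q Theta
                <= (L%:R * K%:R `^ (q - 1))%:E * energy pow_q theta)%E]).
Proof.
have lfX : locally_finite (spanning_subgraph F) by exact: locally_finite_spanning.
split=> [Phi gPhi alpha_fin theta uth _|q q1 pow_q theta uth _].
- have /fineK bE := beta_fin_num gPhi K_ge1 alpha_fin.
  rewrite -bE -EFinM.
  apply: (reroute_unit_flow lfX H_locally_finite iota_injective K_ge1
    gamma_repair gamma_controlled gPhi _ uth).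
  by rewrite bE.
- apply: (reroute_unit_flow lfX H_locally_finite iota_injective K_ge1
    gamma_repair gamma_controlled (is_gauge_powR q1) _ uth).
  exact: beta_powR_le.
Qed.
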